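(* Let $R$ be a commutative computable ring, let $\mathfrak{m}=\langle m_1,\ldots,m_k\rangle$ be a finitely generated maximal ideal in $R$, and let $\mathtt{m}:=\begin{pmatrix}m_1\\ \vdots\\ m_k\end{pmatrix}\in R^{k\times 1}$ be the column of generators of $\mathfrak m$. Let $A=\frac{\tilde{A}}{1}\in R_{\mathfrak m}^{m\times n}$ and $b=\frac{\tilde{b}}{1}\in R_{\mathfrak m}^{1\times n}$ with numerator matrices $\tilde{A}\in R^{m\times n}$ and $\tilde{b}\in R^{1\times n}$ over $R$. There exists a row matrix $t\in R_{\mathfrak m}^{1\times m}$ with $tA+b=0$ if and only if there exists a matrix $\tilde{s}\in R^{1\times(m+k)}$ satisfying $$\tilde{s}\begin{pmatrix}\tilde{A}\\ \mathtt{m}\tilde{b}\end{pmatrix}+\tilde{b}=0 .$$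
   Context: $R_{\mathfrak m}$ is the localization of $R$ at $\mathfrak m$, i.e. $S^{-1}R$ with $S=R\setminus\mathfrak m$. For a matrix $\tilde C$ over $R$ and $s\in S$, $\frac{\tilde C}{s}$ denotes the matrix over $R_{\mathfrak m}$ with entries $\tilde C_{ij}/s$. The matrix $\begin{pmatrix}\tilde{A}\\ \mathtt{m}\tilde{b}\end{pmatrix}\in R^{(m+k)\times n}$ is obtained by stacking $\tilde A$ on top of the $k\times n$-matrix $\mathtt m\tilde b$ (whose rows are $m_1\tilde b,\dots,m_k\tilde b$). The integer $m$ (number of rows of $A$) is unrelated to the column $\mathtt m$. A ring $R$ is computable if linear systems over it can be effectively solved: there are algorithms which, for matrices $A,B$ over $R$ with the same number of columns, compute (i) a matrix $X$ whose rows generate the kernel of $x\mapsto xA$, and (ii) matrices $N,T$ with $N=TA+B$ such that the $i$-th row of $N$ is zero whenever the $i$-th row of $B$ is an $R$-linear combination of the rows of $A$; and likewise for the transposed systems $AX=B$. *)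

(* Defs.v *)
From HB Require Import structures.
From mathcomp Require Import all_boot all_algebra.
From mathcomp Require Import boolp ring.

Set Implicit Arguments.
Unset Strict Implicit.
Unset Printing Implicit Defensive.

Import GRing.Theory.
Local Open Scope ring_scope.
Local Open Scope quotient_scope.

(* The members of [idealr R] are proper, so this is maximality among proper
   ideals. *)
HB.mixin Record isMaximalIdealr (R : nzRingType) (I : R -> bool) := {
  maximal_idealr_subproof :
    forall J : idealr R, {subset I <= J} -> {subset J <= I}
}.

#[short(type="maximal_idealr")]
HB.structure Definition MaximalIdealr (R : nzRingType) :=
  {I of Idealr R I & isMaximalIdealr R I}.

Section MaximalIdealTheory.
Variables (R : comNzRingType) (M : maximal_idealr R).

Lemma maximal_idealr_prime : prime_idealr_closed (M : {pred R}).
Proof.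
move=> u v uvM; apply/orP; have [uM|uM] := boolP (u \in M); [by left|right].
pose J : {pred R} := fun x => `[< exists a, x - a * u \in M >].
have J1 : 1 \in J.
  apply: contraNT uM => J1.
  have JI : idealr_closed J.
    split=> //.
      by apply/asboolP; exists 0; rewrite mul0r subr0 rpred0.
    move=> a x y /asboolP[c cM] /asboolP[d dM].
    apply/asboolP; exists (a * c + d).
    have -> : a * x + y - (a * c + d) * u = a * (x - c * u) + (y - d * u).
      by rewrite mulrBr mulrDl mulrA opprD addrACA.
    by rewrite rpredD ?idealMr.
  pose JB := isIdealr.Build R J JI.
  pose JJ : idealr R := HB.pack J JB.
  apply: (@maximal_idealr_subproof R M JJ).
    move=> x xM; apply/asboolP; exists 0.
    by rewrite mul0r subr0.
  by apply/asboolP; exists 1; rewrite mul1r subrr rpred0.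
case/asboolP: J1 => a aM.
rewrite [v](_ : _ = v * (1 - a * u) + a * (u * v)); last by ring.
by apply: rpredD; apply: idealMr.
Qed.

Definition idealr_compl : {pred R} := [predC M].

Lemma idealr_compl_mulr_closed : mulr_closed idealr_compl.
Proof.
split=> [|x y]; rewrite !inE; first by rewrite idealr1.
move=> xM yM; apply/negP => /maximal_idealr_prime.
by rewrite (negPf xM) (negPf yM).
Qed.

HB.instance Definition _ :=
  GRing.isMulClosed.Build R idealr_compl idealr_compl_mulr_closed.

End MaximalIdealTheory.

Section Localization.
Variables (R : comNzRingType) (S : mulrClosed R).

Definition loc_denom := {s : R | s \in S}.

Definition loc_denom1 : loc_denom := exist _ 1 (rpred1 S).

Definition loc_denomM (s t : loc_denom) : loc_denom :=
  exist _ (val s * val t) (rpredM (valP s) (valP t)).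

Local Notation ratio := (R * loc_denom)%type.
Implicit Types (x y z : ratio).

(* a / s = b / t iff u (a t - b s) = 0 for some u in S; the factor u matters as
   R may have zero divisors. *)
Definition loc_equiv x y : bool :=
  `[< exists2 u, u \in S & u * (x.1 * val y.2 - y.1 * val x.2) = 0 >].

Lemma loc_equiv_refl : reflexive loc_equiv.
Proof. by move=> x; apply/asboolP; exists 1; rewrite ?rpred1// subrr mulr0. Qed.

Lemma loc_equiv_sym : symmetric loc_equiv.
Proof.
by move=> x y; apply/asboolP/asboolP => -[u uS e]; exists u => //;
   rewrite -opprB mulrN e oppr0.
Qed.

Lemma loc_equiv_trans : transitive loc_equiv.
Proof.
move=> [b t] [a s] [c r] /asboolP[/= u uS e] /asboolP[/= v vS f].
apply/asboolP; exists (u * v * val t) => /=.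
  by rewrite !rpredM // (valP t).
have -> : u * v * val t * (a * val r - c * val s) =
  v * val r * (u * (a * val t - b * val s)) +
  u * val s * (v * (b * val r - c * val t)) by ring.
by rewrite e f !mulr0 addr0.
Qed.

Canonical loc_equiv_canonical :=
  EquivRel loc_equiv loc_equiv_refl loc_equiv_sym loc_equiv_trans.

Definition localization := {eq_quot loc_equiv}.

HB.instance Definition _ : EqQuotient _ loc_equiv localization :=
  EqQuotient.on localization.
HB.instance Definition _ := Choice.on localization.

Lemma loc_eqlP x y :
  reflect (exists2 u, u \in S & u * (x.1 * val y.2 - y.1 * val x.2) = 0)
          (\pi_localization x == \pi_localization y).
Proof. by rewrite eqmodE; apply: asboolP. Qed.

Lemma loc_repr_eq x :
  exists2 u, u \in S & u * (x.1 * val (repr (\pi_localization x)).2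
                            - (repr (\pi_localization x)).1 * val x.2) = 0.
Proof. by apply/loc_eqlP; rewrite reprK. Qed.

Definition ratio_add x y : ratio :=
  (x.1 * val y.2 + y.1 * val x.2, loc_denomM x.2 y.2).
Definition ratio_opp x : ratio := (- x.1, x.2).
Definition ratio_mul x y : ratio := (x.1 * y.1, loc_denomM x.2 y.2).

Definition loc_add := lift_op2 localization ratio_add.
Definition loc_opp := lift_op1 localization ratio_opp.
Definition loc_mul := lift_op2 localization ratio_mul.

Lemma loc_pi_add : {morph \pi : x y / ratio_add x y >-> loc_add x y}.
Proof.
move=> x y; unlock loc_add; apply/eqP/loc_eqlP => /=.
have [u uS e] := loc_repr_eq x; have [v vS f] := loc_repr_eq y.
move: (repr (\pi_localization x)) (repr (\pi_localization y)) e f =>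
  [a' s'] [b' t'] /=.
case: x y => [a s] [b t] /= e f.
exists (u * v); first by rewrite rpredM.
rewrite [LHS](_ : _ = v * val t * val t' * (u * (a * val s' - a' * val s)) +
   u * val s * val s' * (v * (b * val t' - b' * val t)));
  last by rewrite /=; ring.
by rewrite e f !mulr0 addr0.
Qed.
Canonical loc_pi_add_morph := PiMorph2 loc_pi_add.

Lemma loc_pi_opp : {morph \pi : x / ratio_opp x >-> loc_opp x}.
Proof.
move=> x; unlock loc_opp; apply/eqP/loc_eqlP => /=.
have [u uS e] := loc_repr_eq x; exists u => //.
by rewrite !mulNr -opprD mulrN e oppr0.
Qed.
Canonical loc_pi_opp_morph := PiMorph1 loc_pi_opp.

Lemma loc_pi_mul : {morph \pi : x y / ratio_mul x y >-> loc_mul x y}.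
Proof.
move=> x y; unlock loc_mul; apply/eqP/loc_eqlP => /=.
have [u uS e] := loc_repr_eq x; have [v vS f] := loc_repr_eq y.
move: (repr (\pi_localization x)) (repr (\pi_localization y)) e f =>
  [a' s'] [b' t'] /=.
case: x y => [a s] [b t] /= e f.
exists (u * v); first by rewrite rpredM.
rewrite [LHS](_ : _ = v * b * val t' * (u * (a * val s' - a' * val s)) +
   u * a' * val s * (v * (b * val t' - b' * val t)));
  last by rewrite /=; ring.
by rewrite e f !mulr0 addr0.
Qed.
Canonical loc_pi_mul_morph := PiMorph2 loc_pi_mul.

Definition loc_frac (a : R) (s : loc_denom) : localization :=
  \pi_localization (a, s).

Lemma loc_pi_eqN x y : x.1 * val y.2 = y.1 * val x.2 ->
  \pi_localization x = \pi_localization y.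
Proof.
by move=> e; apply/eqP/loc_eqlP; exists 1; rewrite ?rpred1// e subrr mulr0.
Qed.

Lemma loc_addA : associative loc_add.
Proof.
elim/quotW=> x; elim/quotW=> y; elim/quotW=> z; rewrite !piE.
by apply: loc_pi_eqN => /=; ring.
Qed.

Lemma loc_addC : commutative loc_add.
Proof.
elim/quotW=> x; elim/quotW=> y; rewrite !piE; apply: loc_pi_eqN => /=; ring.
Qed.

Lemma loc_add0 : left_id (loc_frac 0 loc_denom1) loc_add.
Proof. elim/quotW=> x; rewrite !piE; apply: loc_pi_eqN => /=; ring. Qed.

Lemma loc_addN : left_inverse (loc_frac 0 loc_denom1) loc_opp loc_add.
Proof. elim/quotW=> x; rewrite !piE; apply: loc_pi_eqN => /=; ring. Qed.

HB.instance Definition _ :=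
  GRing.isZmodule.Build localization loc_addA loc_addC loc_add0 loc_addN.

Lemma loc_mulA : associative loc_mul.
Proof.
elim/quotW=> x; elim/quotW=> y; elim/quotW=> z; rewrite !piE.
by apply: loc_pi_eqN => /=; ring.
Qed.

Lemma loc_mulC : commutative loc_mul.
Proof.
elim/quotW=> x; elim/quotW=> y; rewrite !piE; apply: loc_pi_eqN => /=; ring.
Qed.

Lemma loc_mul1 : left_id (loc_frac 1 loc_denom1) loc_mul.
Proof. elim/quotW=> x; rewrite !piE; apply: loc_pi_eqN => /=; ring. Qed.

Lemma loc_mulDl : left_distributive loc_mul loc_add.
Proof.
elim/quotW=> x; elim/quotW=> y; elim/quotW=> z; rewrite !piE.
by apply: loc_pi_eqN => /=; ring.
Qed.

(* Only a pzRing, as S^-1 R is trivial if 0 \in S. *)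
HB.instance Definition _ :=
  GRing.Zmodule_isComPzRing.Build localization
    loc_mulA loc_mulC loc_mul1 loc_mulDl.

Lemma loc_frac_eq (a b : R) (s t : loc_denom) :
  loc_frac a s = loc_frac b t <->
  exists2 u, u \in S & u * (a * val t - b * val s) = 0.
Proof. by split=> [/eqP/loc_eqlP|e]//; apply/eqP/loc_eqlP. Qed.

Lemma loc_fracD (a b : R) (s t : loc_denom) :
  loc_frac a s + loc_frac b t =
  loc_frac (a * val t + b * val s) (loc_denomM s t).
Proof. by rewrite /loc_frac [LHS]piE. Qed.

Lemma loc_fracN (a : R) (s : loc_denom) : - loc_frac a s = loc_frac (- a) s.
Proof. by rewrite /loc_frac [LHS]piE. Qed.

Lemma loc_fracM (a b : R) (s t : loc_denom) :
  loc_frac a s * loc_frac b t = loc_frac (a * b) (loc_denomM s t).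
Proof. by rewrite /loc_frac [LHS]piE. Qed.

Lemma loc_fracW (P : localization -> Prop) :
  (forall a s, P (loc_frac a s)) -> forall q, P q.
Proof. by move=> H; elim/quotW=> -[a s]; apply: H. Qed.

Definition loc_frac_mx p q (C : 'M[R]_(p, q)) (s : loc_denom) :
  'M[localization]_(p, q) :=
  \matrix_(i, j) loc_frac (C i j) s.

End Localization.

Arguments loc_denom1 {R S}.
Arguments loc_frac {R S}.
Arguments loc_frac_mx {R S p q}.

Definition localization_at (R : comNzRingType) (M : maximal_idealr R) :=
  localization (idealr_compl M : mulrClosed R).

(* The algorithms are functions of the type theory, given as data. *)
Record computable_ring (R : nzRingType) := ComputableRing {
  kerl_size : forall m n, 'M[R]_(m, n) -> nat;
  kerl : forall m n (A : 'M[R]_(m, n)), 'M[R]_(kerl_size A, m);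
  kerlP : forall m n (A : 'M[R]_(m, n)) (x : 'rV[R]_m),
    x *m A = 0 <-> exists y : 'rV[R]_(kerl_size A), x = y *m kerl A;

  reducel_N : forall m n p, 'M[R]_(m, n) -> 'M[R]_(p, n) -> 'M[R]_(p, n);
  reducel_T : forall m n p, 'M[R]_(m, n) -> 'M[R]_(p, n) -> 'M[R]_(p, m);
  reducelE : forall m n p (A : 'M[R]_(m, n)) (B : 'M[R]_(p, n)),
    reducel_N A B = reducel_T A B *m A + B;
  reducel_eq0 : forall m n p (A : 'M[R]_(m, n)) (B : 'M[R]_(p, n)) (i : 'I_p),
    (exists x : 'rV[R]_m, row i B = x *m A) -> row i (reducel_N A B) = 0;

  kerr_size : forall m n, 'M[R]_(m, n) -> nat;
  kerr : forall m n (A : 'M[R]_(m, n)), 'M[R]_(n, kerr_size A);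
  kerrP : forall m n (A : 'M[R]_(m, n)) (x : 'cV[R]_n),
    A *m x = 0 <-> exists y : 'cV[R]_(kerr_size A), x = kerr A *m y;

  reducer_N : forall m n p, 'M[R]_(m, n) -> 'M[R]_(m, p) -> 'M[R]_(m, p);
  reducer_T : forall m n p, 'M[R]_(m, n) -> 'M[R]_(m, p) -> 'M[R]_(n, p);
  reducerE : forall m n p (A : 'M[R]_(m, n)) (B : 'M[R]_(m, p)),
    reducer_N A B = A *m reducer_T A B + B;
  reducer_eq0 : forall m n p (A : 'M[R]_(m, n)) (B : 'M[R]_(m, p)) (j : 'I_p),
    (exists x : 'cV[R]_n, col j B = A *m x) -> col j (reducer_N A B) = 0
}.

(* The ideal <g_1, ..., g_k> is I; x%:M is x as a 1 x 1 matrix. *)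
Definition generates (R : comNzRingType) (k : nat) (g : 'cV[R]_k)
    (I : {pred R}) : Prop :=
  forall x : R, x \in I <-> exists c : 'rV[R]_k, x%:M = c *m g.

(* Main.v *)
Require Import Defs.
From HB Require Import structures.
From mathcomp Require Import all_boot all_algebra.
From mathcomp Require Import boolp ring.

(** The idea is to clear denominators.  Over any localization [S^-1 R], the
    system [t A + b = 0] has a solution exactly when there are a row [u] over [R]
    and a denominator [d] in [S] with [u At + d bt = 0]
    ([loc_solvableP]): a solution has a common denominator, and the finitely
    many elements of [S] that kill the entries of the resulting numerator can be
    multiplied into a single such element.

    For [S = R \ M] it remains to make the unknown denominator [d] part of a
    linear system.  Since [R / M] is a field, [d] has an inverse [a] modulo
    [M] ([maximal_idealr_inv]), so after multiplying by [a] the denominator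
    may be taken congruent to 1 modulo [M], that is, of the form [1 + v mm]
    with [v] a row of coefficients on the generators [mm].  The equation
    [u At + (1 + v mm) bt = 0] is then linear in the unknowns [(u, v)], and its
    matrix is [At] stacked on [mm bt].  Conversely, [1 + v mm] is never in [M],
    so each solution of the stacked system yields a denominator. *)

Import GRing.Theory.
Local Open Scope ring_scope.

(** An element outside [M] is invertible modulo [M]: otherwise the ideal
    [M + R d] would be proper and strictly larger than [M]. *)
Lemma maximal_idealr_inv (R : comNzRingType) (M : maximal_idealr R) (d : R) :
  d \notin M -> exists a, 1 - a * d \in M.
Proof.
move=> dM; apply: contrapT => noinv.
pose J : {pred R} := fun x => `[< exists a, x - a * d \in M >].
have JI : idealr_closed J.
  split=> [||a x y /asboolP[c cM] /asboolP[e eM]].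
  - by apply/asboolP; exists 0; rewrite mul0r subr0 rpred0.
  - by apply/asboolP.
  - apply/asboolP; exists (a * c + e).
    have -> : a * x + y - (a * c + e) * d = a * (x - c * d) + (y - e * d).
      by ring.
    by rewrite rpredD ?idealMr.
pose JB := isIdealr.Build R J JI.
pose JJ : idealr R := HB.pack J JB.
move/negP: dM; apply; apply: (@maximal_idealr_subproof R M JJ).
  by move=> x xM; apply/asboolP; exists 0; rewrite mul0r subr0.
by apply/asboolP; exists 1; rewrite mul1r subrr rpred0.
Qed.

Section FractionMatrices.
Variables (R : comNzRingType) (S : mulrClosed R).
Implicit Types (s : loc_denom S).

Lemma loc_frac_sum (I : finType) (F : I -> R) s :
  \sum_i loc_frac (F i) s = loc_frac (\sum_i F i) s.
Proof.
apply: (big_ind2 (fun x y => x = loc_frac y s)) => //.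
  by apply/loc_frac_eq; exists 1; rewrite ?rpred1 //=; ring.
move=> _ x _ y -> ->; rewrite loc_fracD; apply/loc_frac_eq.
by exists 1; rewrite ?rpred1 //=; ring.
Qed.

Lemma loc_frac_mxM1 p q r (U : 'M[R]_(p, q)) (C : 'M[R]_(q, r)) s :
  loc_frac_mx U s *m loc_frac_mx C loc_denom1 = loc_frac_mx (U *m C) s.
Proof.
apply/matrixP=> i j; rewrite !mxE -loc_frac_sum; apply: eq_bigr => l _.
rewrite !mxE loc_fracM; apply/loc_frac_eq.
by exists 1; rewrite ?rpred1 //=; ring.
Qed.

Lemma loc_frac_mxD1 p q (C D : 'M[R]_(p, q)) s :
  loc_frac_mx C s + loc_frac_mx D loc_denom1 = loc_frac_mx (C + val s *: D) s.
Proof.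
apply/matrixP=> i j; rewrite !mxE loc_fracD; apply/loc_frac_eq.
by exists 1; rewrite ?rpred1 //=; ring.
Qed.

(** The product of all the denominators serves as a common one. *)
Lemma loc_common_denom (I : finType) (f : I -> localization S) :
  exists (a : I -> R) s, forall i, f i = loc_frac (a i) s.
Proof.
have /choice[g gE] : forall i, exists x : R * loc_denom S,
    f i = loc_frac x.1 x.2.
  by move=> i; elim/(@loc_fracW R S): (f i) => a s; exists (a, s).
have sS : \prod_i val (g i).2 \in S by apply: rpred_prod => i _; apply: valP.
exists (fun i => (g i).1 * \prod_(j | j != i) val (g j).2).
exists (exist (fun x => x \in S) _ sS) => i.
rewrite gE; apply/loc_frac_eq; exists 1; rewrite ?rpred1 //= (bigD1 i) //=.
by ring.
Qed.

Lemma loc_frac_mx_common_denom p q (T : 'M[localization S]_(p, q)) :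
  exists U s, T = loc_frac_mx U s.
Proof.
have [a [s aE]] := loc_common_denom _ (fun ij : 'I_p * 'I_q => T ij.1 ij.2).
exists (\matrix_(i, j) a (i, j)), s.
by apply/matrixP=> i j; rewrite !mxE -aE.
Qed.

(** Each entry is killed by some element of [S], and the product of these
    finitely many elements kills the whole matrix. *)
Lemma loc_frac_mx_eq0 p q (C : 'M[R]_(p, q)) s :
  loc_frac_mx C s = 0 <-> exists2 w, w \in S & w *: C = 0.
Proof.
split=> [C0|[w wS wC0]]; last first.
  apply/matrixP=> i j; rewrite !mxE; apply/loc_frac_eq; exists w => //=.
  have := congr1 (fun X : 'M_(p, q) => X i j) wC0.
  by rewrite !mxE => wij; ring: wij.
have /choice[w wP] : forall ij, exists w, w \in S /\ w * C ij.1 ij.2 = 0.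
  move=> [i j]; have := congr1 (fun X : 'M_(p, q) => X i j) C0.
  rewrite !mxE => /loc_frac_eq[w wS /= wij]; exists w; split=> //.
  by ring: wij.
exists (\prod_ij w ij); first by apply: rpred_prod => ij _; case: (wP ij).
apply/matrixP=> i j; rewrite !mxE (bigD1 (i, j)) //= mulrAC.
by have [_ /= ->] := wP (i, j); rewrite mul0r.
Qed.

(** A linear system over [R], read over [S^-1 R], is a system over [R] with one
    more unknown: the common denominator [d] of the solution, which has to lie
    in [S]. *)
Lemma loc_solvableP p q r (A : 'M[R]_(p, q)) (B : 'M[R]_(r, q)) :
  (exists T : 'M[localization S]_(r, p),
     T *m loc_frac_mx A loc_denom1 + loc_frac_mx B loc_denom1 = 0) <->
  (exists U, exists2 d, d \in S & U *m A + d *: B = 0).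
Proof.
split=> [[T]|[U [d dS UdE]]].
  have [U [s ->]] := loc_frac_mx_common_denom _ _ T.
  rewrite loc_frac_mxM1 loc_frac_mxD1 => /loc_frac_mx_eq0[w wS].
  rewrite scalerDr scalerA scalemxAl => UdE.
  by exists (w *: U), (w * val s) => //; rewrite rpredM // (valP s).
exists (loc_frac_mx U (exist (fun x => x \in S) d dS)).
rewrite loc_frac_mxM1 loc_frac_mxD1; apply/loc_frac_mx_eq0.
by exists 1; rewrite ?rpred1 // scale1r.
Qed.

End FractionMatrices.

Theorem proposition4p5 (R : comNzRingType) (R_computable : computable_ring R)
    (M : maximal_idealr R) (k : nat) (mm : 'cV[R]_k)
    (mm_generates : generates mm M)
    (m n : nat) (At : 'M[R]_(m, n)) (bt : 'rV[R]_n)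
    (A : 'M[localization_at M]_(m, n)) (b : 'rV[localization_at M]_n)
    (A_def : A = loc_frac_mx At loc_denom1)
    (b_def : b = loc_frac_mx bt loc_denom1) :
  (exists t : 'rV[localization_at M]_m, t *m A + b = 0) <->
  (exists st : 'rV[R]_(m + k), st *m col_mx At (mm *m bt) + bt = 0).
Proof.
rewrite A_def b_def; split=> [/loc_solvableP[u [d dM udE]]|[st]].
  have [a /mm_generates[c cE]] := maximal_idealr_inv _ M d dM.
  (* Scaled by [a], the denominator is [a * d = 1 - c *m mm]. *)
  exists (row_mx (a *: u) (- c)).
  rewrite mul_row_col mulmxA mulNmx -cE mulNmx mul_scalar_mx scalerBl scale1r.
  by rewrite opprB addrA subrK -scalemxAl -scalerA -scalerDr udE scaler0.
rewrite -[st]hsubmxK mul_row_col mulmxA.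
set u := lsubmx st; set v := rsubmx st => stE.
have vE : v *m mm = ((v *m mm) 0 0)%:M by apply: mx11_scalar.
apply/loc_solvableP; exists u, (1 + (v *m mm) 0 0).
  have vM : (v *m mm) 0 0 \in M by apply/mm_generates; exists v.
  by rewrite inE rpredDr // idealr1.
by rewrite scalerDl scale1r -mul_scalar_mx -vE (addrC bt) addrA.
Qed.
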